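(* Let $n$ be a positive integer, let $\tau > 0$, let $a_0, \dotsc, a_{n-1}, \alpha_0, \dotsc, \alpha_{n-1} \in \mathbb{R}$, and consider the function $\Delta : \mathbb{C} \to \mathbb{C}$ given by $$\Delta(s) = s^n + \sum_{k=0}^{n-1} a_k s^k + e^{-s\tau} \sum_{k=0}^{n-1} \alpha_k s^k .$$ Let $s_0 \in \mathbb{R}$. (a) The number $s_0$ is a root of multiplicity $2n$ of $\Delta$ if and only if, for every $k \in \{0, \dotsc, n-1\}$, $$a_k = \binom{n}{k} (-s_0)^{n-k} + (-1)^{n-k}\, n! \sum_{j=k}^{n-1} \binom{j}{k} \binom{2n-j-1}{n-1} \frac{s_0^{j-k}}{j!\,\tau^{n-j}}$$ and $$\alpha_k = (-1)^{n-1} e^{s_0 \tau} \sum_{j=k}^{n-1} \frac{(-1)^{j-k} (2n-j-1)!}{k!\, (j-k)!\, (n-j-1)!}\, \frac{s_0^{j-k}}{\tau^{n-j}} .$$ (b) If, for every $k \in \{0, \dotsc, n-1\}$, $$a_k = \binom{n}{k} (-s_0)^{n-k} + (-1)^{n-k}\, n! \sum_{j=k}^{n-1} \binom{j}{k} \binom{2n-j-1}{n-1} \frac{s_0^{j-k}}{j!\,\tau^{n-j}}$$ and $$\alpha_k = (-1)^{n-1} e^{s_0 \tau} \sum_{j=k}^{n-1} \frac{(-1)^{j-k} (2n-j-1)!}{k!\, (j-k)!\, (n-j-1)!}\, \frac{s_0^{j-k}}{\tau^{n-j}} ,$$ then $s_0$ is a strictly dominant root of $\Delta$.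
   Context: A root $s_0 \in \mathbb{C}$ of a function $Q : \mathbb{C} \to \mathbb{C}$ is called strictly dominant if every $s \in \mathbb{C} \setminus \{s_0\}$ with $Q(s) = 0$ satisfies $\operatorname{Re} s < \operatorname{Re} s_0$. Multiplicity of a root means its order of vanishing as a zero of the entire function $\Delta$. The convention $s_0^0 = 1$ is used, including when $s_0 = 0$. *)

(* Defs.v *)
From Stdlib Require Export Arith Reals.
From Coquelicot Require Export Coquelicot.

Local Open Scope R_scope.

(* exp (x + iy) = e^x (cos y + i sin y), as Coquelicot has no complex
   exponential. *)
Definition Cexp (z : C) : C :=
  (exp (Re z) * cos (Im z), exp (Re z) * sin (Im z)).

(* [F k] is the [k]-th complex derivative of [f] on the whole plane, so [f] is
   entire; [F] is determined by [f]. For [m = 0] this says that [z0] is not a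
   root. *)
Definition zero_of_order (f : C -> C) (z0 : C) (m : nat) : Prop :=
  exists F : nat -> C -> C,
    (forall z, F 0%nat z = f z) /\
    (forall k z,
       is_derive (K := C_AbsRing) (V := C_NormedModule) (F k) z (F (S k) z)) /\
    (forall k, (k < m)%nat -> F k z0 = RtoC 0) /\
    F m z0 <> RtoC 0.

Definition strictly_dominant_root (Q : C -> C) (s0 : C) : Prop :=
  Q s0 = RtoC 0 /\
  forall s : C, s <> s0 -> Q s = RtoC 0 -> Re s < Re s0.

(* Only [a k] and [alpha k] with [k < n] occur. The sums run over
   [0 <= k <= n - 1] with truncated subtraction, hence require [0 < n]. *)
Definition quasipoly (n : nat) (tau : R) (a alpha : nat -> R) (s : C) : C :=
  (s ^ n + sum_n (fun k => RtoC (a k) * s ^ k) (n - 1)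
   + Cexp (- (s * RtoC tau))
     * sum_n (fun k => RtoC (alpha k) * s ^ k) (n - 1))%C.

(* [Binomial.C p q] is the real binomial coefficient; it is only used with
   [q <= p], and all the subtractions of naturals are exact when [k < n]. *)
Definition coef_a (n : nat) (tau s0 : R) (k : nat) : R :=
  Binomial.C n k * (- s0) ^ (n - k)
  + (-1) ^ (n - k) * INR (fact n)
    * sum_n_m (fun j => Binomial.C j k * Binomial.C (2 * n - j - 1) (n - 1)
                        * (s0 ^ (j - k) / (INR (fact j) * tau ^ (n - j))))
              k (n - 1).

Definition coef_alpha (n : nat) (tau s0 : R) (k : nat) : R :=
  (-1) ^ (n - 1) * exp (s0 * tau)
  * sum_n_m (fun j => ((-1) ^ (j - k) * INR (fact (2 * n - j - 1))
                       / (INR (fact k) * INR (fact (j - k))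
                          * INR (fact (n - j - 1))))
                      * (s0 ^ (j - k) / tau ^ (n - j)))
            k (n - 1).

(* Main.v *)
Require Import Defs.
From Stdlib Require Import Reals Lra Lia.
From Coquelicot Require Import Coquelicot.

(** Put [x = s - s0]. Up to the shift, [quasipoly] is an exponential polynomial
    [f x = p x + exp (- tau x) q x] with [p] monic of degree [n] and [q] of degree
    less than [n]. The proof rests on two facts about such functions.

    Unisolvence ([expoly_unisolvent]). If [deg p < m], [deg q < n] and [f] has a
    zero of order at least [m + n] at one point, then [p = q = 0]. The operator
    [D + tau] costs one order of vanishing; it lowers the degree of [q] and keeps
    that of [p], because [(D + tau) (exp (- tau x) q) = exp (- tau x) q']. After
    [n] applications only a polynomial of degree less than [m] with a zero of order
    [m] is left. Consequently at most one choice of the coefficients gives order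
    [2 n], and order [2 n + 1] is impossible since [p] is monic.

    Differential equation. Expanded in powers of [x], the coefficients of the
    theorem satisfy two-term recurrences, which say exactly that [f] solves
<<
      x f'' + (tau x + 1 - 2 n) f' - n tau f = 0.
>>
    Differentiating it [k] times and putting [x = 0] expresses [f^(k+1) 0] through
    [f^(k) 0] as long as [k + 1 < 2 n]; as [f 0 = 0], the order at [0] is at least
    [2 n] ([kummer_ode_vanishes]). This gives (a).

    The equation also gives (b). Up to a factor, [f x] is
    [x ^ (2 n) M(n, 2 n + 1, - tau x)], and Hille's argument locates the zeros of
    the Kummer function [M]. Suppose [f w = 0] with
    [0 <= Re w], [w <> 0], and put [u r = exp (tau r w / 2) f (r w)]. The equation
    in the form [(r ^ (1 - 2 n) u')' = r ^ (- 2 n) w (tau ^ 2 r w / 4 + tau / 2) u]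
    shows that [E r = Re (conj w u' (conj u)) r ^ (1 - 2 n)] is nondecreasing for
    [0 < r <= 1]. It tends to [0] at [0], since [f] vanishes there to order [2 n], and
    [E 1 = 0]. So [E] is constant, which forces [f] to vanish on the segment from
    [0] to [w] ([kummer_ode_ray_zero]), against unisolvence. *)

Local Open Scope R_scope.
Local Notation is_Cderive := (is_derive (K := C_AbsRing) (V := C_NormedModule)).

(** * Complex derivatives *)

Lemma is_Cderive_iff (f : C -> C) (z l : C) :
  is_Cderive f z l <->
  forall eps : R, 0 < eps -> exists d : R, 0 < d /\
    forall h : C, Cmod h < d ->
      Cmod (f (z + h) - f z - h * l)%C <= eps * Cmod h.
Proof.
  split.
  - intros [_ H] eps Heps.
    destruct (H z (fun P HP => HP) (mkposreal eps Heps)) as [d Hd].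
    exists d; split; [apply cond_pos|]. intros h Hh.
    specialize (Hd (z + h)%C).
    replace (f (z + h) - f z - h * l)%C
      with (f (z + h) - f z - ((z + h) - z) * l)%C by ring.
    replace (Cmod h) with (Cmod (z + h - z)%C) by (f_equal; ring).
    apply Hd. change (Cmod (z + h - z)%C < d).
    now replace (z + h - z)%C with h by ring.
  - intros H; split.
    + apply is_linear_scal_l.
    + intros x Hx eps.
      pose proof (is_filter_lim_locally_unique (K := C_AbsRing)
        (V := AbsRing_NormedModule C_AbsRing) _ _ Hx) as <-.
      destruct (H eps (cond_pos eps)) as [d [Hd HH]].
      exists (mkposreal d Hd). intros y Hy.
      change (Cmod (f y - f z - (y - z) * l)%C <= eps * Cmod (y - z)%C).
      replace (f y) with (f (z + (y - z))%C) by (f_equal; ring).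
      apply HH. exact Hy.
Qed.

Lemma Cmod_le_components (z : C) : Cmod z <= Rabs (Re z) + Rabs (Im z).
Proof.
  replace z with (RtoC (Re z) + Ci * RtoC (Im z))%C at 1
    by (destruct z; apply injective_projections; simpl; ring).
  eapply Rle_trans; [apply Cmod_triangle|].
  rewrite Cmod_mult, !Cmod_R, Cmod_Ci. lra.
Qed.

Lemma first_order (f : R -> R) (l eps : R) :
  is_derive f 0 l -> 0 < eps ->
  exists d, 0 < d /\ forall x, Rabs x < d ->
    Rabs (f x - f 0 - l * x) <= eps * Rabs x.
Proof.
  intros H%is_derive_Reals Heps. destruct (H eps Heps) as [d Hd].
  exists d; split; [apply cond_pos|]. intros x Hx.
  destruct (Req_dec x 0) as [->|Hx0].
  { replace (f 0 - f 0 - l * 0) with 0 by ring. rewrite Rabs_R0; lra. }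
  specialize (Hd x Hx0 Hx). rewrite Rplus_0_l in Hd.
  replace (f x - f 0 - l * x) with (((f x - f 0) / x - l) * x) by (field; easy).
  rewrite Rabs_mult. apply Rmult_le_compat_r; [apply Rabs_pos | lra].
Qed.

(** With [h = (x, y)], the components of [Cexp h - 1 - h] are
    [exp x (cos y - 1) + (exp x - 1 - x)] and
    [exp x (sin y - y) + (exp x - 1) y], so the first-order expansions of the
    real functions suffice. *)
Lemma Cexp_first_order (eps : R) : 0 < eps -> exists d, 0 < d /\
  forall h : C, Cmod h < d -> Cmod (Cexp h - 1 - h)%C <= eps * Cmod h.
Proof.
  intros Heps.
  (* The two components add up to at most [9 e |h|]; [e <= 1] gives [exp x <= 3]. *)
  set (e := Rmin (eps / 12) 1).
  assert (He : 0 < e) by (apply Rmin_glb_lt; lra).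
  assert (He1 : e <= eps / 12) by apply Rmin_l.
  assert (He2 : e <= 1) by apply Rmin_r.
  destruct (first_order exp 1 e) as [d1 [Hd1 H1]]; [|easy|].
  { auto_derive; [easy|]. rewrite exp_0; ring. }
  destruct (first_order sin 1 e) as [d2 [Hd2 H2]]; [|easy|].
  { auto_derive; [easy|]. rewrite cos_0; ring. }
  destruct (first_order cos 0 e) as [d3 [Hd3 H3]]; [|easy|].
  { auto_derive; [easy|]. rewrite sin_0; ring. }
  rewrite exp_0 in H1; rewrite sin_0 in H2; rewrite cos_0 in H3.
  exists (Rmin (Rmin d1 d2) (Rmin d3 e)). split.
  { repeat apply Rmin_glb_lt; lra. }
  intros [x y] Hh.
  pose proof (Rmin_l (Rmin d1 d2) (Rmin d3 e)).
  pose proof (Rmin_r (Rmin d1 d2) (Rmin d3 e)).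
  pose proof (Rmin_l d1 d2). pose proof (Rmin_r d1 d2).
  pose proof (Rmin_l d3 e). pose proof (Rmin_r d3 e).
  pose proof (Rle_trans _ _ _ (Rmax_l _ _) (Rmax_Cmod (x, y))) as Hx.
  pose proof (Rle_trans _ _ _ (Rmax_r _ _) (Rmax_Cmod (x, y))) as Hy.
  simpl in Hx, Hy. set (m := Cmod (x, y)) in *.
  specialize (H1 x ltac:(lra)). specialize (H2 y ltac:(lra)).
  specialize (H3 y ltac:(lra)).
  assert (Hex : Rabs (exp x - 1) <= 2 * Rabs x).
  { replace (exp x - 1) with ((exp x - 1 - 1 * x) + x) by ring.
    eapply Rle_trans; [apply Rabs_triang|].
    assert (e * Rabs x <= 1 * Rabs x)
      by (apply Rmult_le_compat_r; [apply Rabs_pos | lra]). lra. }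
  assert (He3 : 0 < exp x <= 3).
  { split; [apply exp_pos|]. apply Rabs_le_between in Hex. lra. }
  assert (Hem : e * Rabs x <= e * m /\ e * Rabs y <= e * m)
    by (split; apply Rmult_le_compat_l; lra).
  eapply Rle_trans; [apply Cmod_le_components|]. simpl.
  assert (A : Rabs (exp x * cos y + - (1) + - x) <= 4 * (e * m)).
  { replace (exp x * cos y + - (1) + - x)
      with (exp x * (cos y - 1 - 0 * y) + (exp x - 1 - 1 * x)) by ring.
    eapply Rle_trans; [apply Rabs_triang|].
    rewrite Rabs_mult, (Rabs_pos_eq (exp x)) by lra.
    assert (exp x * Rabs (cos y - 1 - 0 * y) <= 3 * (e * Rabs y))
      by (apply Rmult_le_compat; try apply Rabs_pos; lra). lra. }
  assert (B : Rabs (exp x * sin y + - 0 + - y) <= 5 * (e * m)).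
  { replace (exp x * sin y + - 0 + - y)
      with (exp x * (sin y - 0 - 1 * y) + (exp x - 1) * y) by ring.
    eapply Rle_trans; [apply Rabs_triang|].
    rewrite !Rabs_mult, (Rabs_pos_eq (exp x)) by lra.
    assert (exp x * Rabs (sin y - 0 - 1 * y) <= 3 * (e * Rabs y))
      by (apply Rmult_le_compat; try apply Rabs_pos; lra).
    assert (Rabs (exp x - 1) * Rabs y <= (2 * e) * m)
      by (apply Rmult_le_compat; try apply Rabs_pos; lra). lra. }
  assert (0 <= m) by apply Cmod_ge_0.
  assert (e * m <= eps / 12 * m) by (apply Rmult_le_compat_r; lra). nra.
Qed.

Lemma Cexp_plus (x y : C) : Cexp (x + y) = (Cexp x * Cexp y)%C.
Proof.
  destruct x as [a b], y as [c d]. unfold Cexp; simpl.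
  rewrite exp_plus, cos_plus, sin_plus.
  apply injective_projections; simpl; ring.
Qed.

Lemma Cexp_R (x : R) : Cexp (RtoC x) = RtoC (exp x).
Proof.
  unfold Cexp; simpl. rewrite cos_0, sin_0.
  apply injective_projections; simpl; ring.
Qed.

Lemma Cexp_neq_0 (z : C) : Cexp z <> RtoC 0.
Proof.
  intros H. assert (E : (Cexp z * Cexp (- z) = 1)%C).
  { rewrite <- Cexp_plus. replace (z + - z)%C with (RtoC 0) by ring.
    now rewrite Cexp_R, exp_0. }
  rewrite H, Cmult_0_l in E. apply RtoC_inj in E. lra.
Qed.

Lemma is_Cderive_Cexp (z : C) : is_Cderive Cexp z (Cexp z).
Proof.
  apply is_Cderive_iff. intros eps Heps.
  assert (Hc : 0 < Cmod (Cexp z)) by apply Cmod_gt_0, Cexp_neq_0.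
  destruct (Cexp_first_order (eps / Cmod (Cexp z))) as [d [Hd H]].
  { now apply Rdiv_lt_0_compat. }
  exists d; split; [easy|]. intros h Hh. specialize (H h Hh).
  rewrite Cexp_plus.
  replace (Cexp z * Cexp h - Cexp z - h * Cexp z)%C
    with (Cexp z * (Cexp h - 1 - h))%C by ring.
  rewrite Cmod_mult. apply (Rmult_le_compat_l (Cmod (Cexp z))) in H; [|lra].
  eapply Rle_trans; [exact H|]. right; field; lra.
Qed.

(** The codomain of [f] carries two uniform structures, one from the modulus and
    one from the product [R * R]; differentiability only refers to the norm, on
    which they agree. *)
Lemma is_Cderive_AbsRing (f : C -> C) (z l : C) :
  is_derive (K := C_AbsRing) (V := AbsRing_NormedModule C_AbsRing) f z l
  <-> is_Cderive f z l.
Proof. split; intros [[H1 H2 H3] H4]; (split; [now split | exact H4]). Qed.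

Lemma is_Cderive_mult (f g : C -> C) (z df dg : C) :
  is_Cderive f z df -> is_Cderive g z dg ->
  is_Cderive (fun x => f x * g x)%C z (df * g z + f z * dg)%C.
Proof.
  intros Hf%is_Cderive_AbsRing Hg%is_Cderive_AbsRing. apply is_Cderive_AbsRing.
  exact (is_derive_mult (K := C_AbsRing) f g z df dg Hf Hg Cmult_comm).
Qed.

Lemma is_Cderive_plus (f g : C -> C) (z df dg : C) :
  is_Cderive f z df -> is_Cderive g z dg ->
  is_Cderive (fun x => f x + g x)%C z (df + dg)%C.
Proof. exact (is_derive_plus f g z df dg). Qed.

Lemma is_Cderive_const (c z : C) : is_Cderive (fun _ => c) z (RtoC 0).
Proof. exact (is_derive_const c z). Qed.

Lemma is_Cderive_id (z : C) : is_Cderive (fun x => x) z (RtoC 1).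
Proof. apply is_Cderive_AbsRing. exact (is_derive_id (K := C_AbsRing) z). Qed.

Lemma is_Cderive_comp (f g : C -> C) (z df dg : C) :
  is_Cderive f (g z) df -> is_Cderive g z dg ->
  is_Cderive (fun x => f (g x)) z (dg * df)%C.
Proof.
  intros Hf Hg%is_Cderive_AbsRing. exact (is_derive_comp f g z df dg Hf Hg).
Qed.

Lemma is_Cderive_unique (f : C -> C) (z l1 l2 : C) :
  is_Cderive f z l1 -> is_Cderive f z l2 -> l1 = l2.
Proof. now intros <-%is_C_derive_unique <-%is_C_derive_unique. Qed.

Lemma is_Cderive_ext (f g : C -> C) (z l : C) :
  (forall x, f x = g x) -> is_Cderive f z l -> is_Cderive g z l.
Proof. exact (is_derive_ext f g z l). Qed.

Lemma is_Cderive_eq (f : C -> C) (z l l' : C) :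
  is_Cderive f z l -> l = l' -> is_Cderive f z l'.
Proof. now intros H <-. Qed.

(** * Order of vanishing *)

Definition deriv_tower (F : nat -> C -> C) : Prop :=
  forall k z, is_Cderive (F k) z (F (S k) z).

(** Order at least [m], as opposed to [zero_of_order], which is exact. *)
Definition vanishes (f : C -> C) (z0 : C) (m : nat) : Prop :=
  exists F : nat -> C -> C,
    (forall z, F 0%nat z = f z) /\ deriv_tower F /\
    (forall k, (k < m)%nat -> F k z0 = RtoC 0).

Lemma zero_of_order_vanishes (f : C -> C) (z0 : C) (m : nat) :
  zero_of_order f z0 m -> vanishes f z0 m.
Proof. intros (F & F0 & HF & V & _). now exists F. Qed.

Lemma vanishes_ext (f g : C -> C) (z0 : C) (m : nat) :
  (forall z, f z = g z) -> vanishes f z0 m -> vanishes g z0 m.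
Proof.
  intros E (F & F0 & HF & V). exists F. split; [|now split].
  intros z. now rewrite F0.
Qed.

Lemma vanishes_minus (f g : C -> C) (z0 : C) (m : nat) :
  vanishes f z0 m -> vanishes g z0 m -> vanishes (fun z => f z - g z)%C z0 m.
Proof.
  intros (F & F0 & HF & VF) (G & G0 & HG & VG).
  exists (fun k z => F k z - G k z)%C. split; [|split].
  - intros z. now rewrite F0, G0.
  - intros k z. exact (is_derive_minus _ _ z _ _ (HF k z) (HG k z)).
  - intros k Hk. rewrite VF, VG by easy. ring.
Qed.

(** The operator [D + c] costs one order of vanishing. *)
Lemma vanishes_twist (f g : C -> C) (z0 : C) (c : R) (m : nat) :
  (forall z, is_Cderive f z (g z)) -> vanishes f z0 (S m) ->
  vanishes (fun z => g z + RtoC c * f z)%C z0 m.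
Proof.
  intros Hg (F & F0 & HF & VF).
  exists (fun k z => F (S k) z + RtoC c * F k z)%C. split; [|split].
  - intros z. rewrite F0. f_equal.
    apply (is_Cderive_unique f z); [|easy].
    apply (is_Cderive_ext (F 0%nat)); [easy | apply HF].
  - intros k z. apply is_Cderive_plus; [apply HF|].
    replace (RtoC c * F (S k) z)%C with (0 * F k z + RtoC c * F (S k) z)%C by ring.
    apply is_Cderive_mult; [apply is_Cderive_const | apply HF].
  - intros k Hk. rewrite !VF by lia. ring.
Qed.

(** * Exponential polynomials *)

Definition peval (N : nat) (p : nat -> R) (z : C) : C :=
  sum_n (fun k => RtoC (p k) * z ^ k)%C N.

Definition expoly (N : nat) (tau : R) (p q : nat -> R) (z : C) : C :=
  (peval N p z + Cexp (- (z * RtoC tau)) * peval N q z)%C.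

(** On coefficients, [twist c] is the operator [D + c]. Since
    [D (exp (- tau z) q) = exp (- tau z) (D - tau) q], differentiating an
    exponential polynomial applies [twist 0] to one coefficient sequence and
    [twist (- tau)] to the other. *)
Definition twist (c : R) (p : nat -> R) : nat -> R :=
  fun k => INR (S k) * p (S k) + c * p k.

Definition support_below (p : nat -> R) (d : nat) : Prop :=
  forall k, (d <= k)%nat -> p k = 0.

Lemma support_below_weaken (p : nat -> R) (d e : nat) :
  support_below p d -> (d <= e)%nat -> support_below p e.
Proof. intros H He k Hk. apply H. lia. Qed.

Lemma support_below_twist (c : R) (p : nat -> R) (d : nat) :
  support_below p d -> support_below (twist c p) d.
Proof. intros H k Hk. unfold twist. rewrite !H by lia. ring. Qed.

Lemma support_below_deriv (p : nat -> R) (d : nat) :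
  support_below p (S d) -> support_below (twist 0 p) d.
Proof. intros H k Hk. unfold twist. rewrite (H (S k)) by lia. ring. Qed.

(** [D + c] is injective on polynomials when [c <> 0], as it multiplies the
    leading coefficient by [c]. *)
Lemma twist_eq_0 (c : R) (p : nat -> R) (d : nat) :
  c <> 0 -> support_below p d -> support_below (twist c p) 0 -> support_below p 0.
Proof.
  intros Hc. induction d as [|d IH]; intros Hd H0; [easy|].
  apply IH; [|easy]. intros k Hk.
  specialize (H0 k ltac:(lia)). unfold twist in H0.
  rewrite (Hd (S k)) in H0 by lia.
  apply (Rmult_eq_reg_l c); [lra | easy].
Qed.

Lemma peval_S (N : nat) (p : nat -> R) (z : C) :
  peval (S N) p z = (peval N p z + RtoC (p (S N)) * z ^ S N)%C.
Proof. unfold peval. now rewrite sum_Sn. Qed.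

Lemma peval_0 (p : nat -> R) (z : C) : peval 0 p z = RtoC (p 0%nat).
Proof. unfold peval. rewrite sum_O. simpl. ring. Qed.

Lemma peval_lin (N : nat) (a b : R) (p q : nat -> R) (z : C) :
  peval N (fun k => a * p k + b * q k) z
  = (RtoC a * peval N p z + RtoC b * peval N q z)%C.
Proof.
  induction N as [|N IH].
  - rewrite !peval_0, RtoC_plus, !RtoC_mult. ring.
  - rewrite !peval_S, IH, RtoC_plus, !RtoC_mult. ring.
Qed.

Lemma peval_ext (N : nat) (p q : nat -> R) (z : C) :
  (forall k, (k <= N)%nat -> p k = q k) -> peval N p z = peval N q z.
Proof.
  intros H. unfold peval. apply sum_n_ext_loc. intros k Hk. now rewrite H.
Qed.

Lemma peval_support_0 (N : nat) (p : nat -> R) (z : C) :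
  support_below p 0 -> peval N p z = RtoC 0.
Proof.
  intros H. rewrite (peval_ext N p (fun k => 0 * p k + 0 * p k)).
  - rewrite peval_lin. ring.
  - intros k _. rewrite H by lia. ring.
Qed.

Lemma peval_support_1 (N : nat) (p : nat -> R) (z : C) :
  support_below p 1 -> peval N p z = RtoC (p 0%nat).
Proof.
  intros H. induction N as [|N IH]; [apply peval_0|].
  rewrite peval_S, IH, (H (S N)) by lia. ring.
Qed.

Lemma is_Cderive_pow (k : nat) (z : C) :
  is_Cderive (fun x => x ^ S k)%C z (RtoC (INR (S k)) * z ^ k)%C.
Proof.
  induction k as [|k IH].
  - simpl. replace (RtoC 1 * 1)%C with (RtoC 1 * 1 + z * 0)%C by ring.
    apply is_Cderive_mult; [apply is_Cderive_id | apply is_Cderive_const].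
  - rewrite S_INR, RtoC_plus.
    replace ((RtoC (INR (S k)) + 1) * z ^ S k)%C
      with (1 * z ^ S k + z * (RtoC (INR (S k)) * z ^ k))%C
      by (simpl Cpow; ring).
    exact (is_Cderive_mult (fun x => x) _ z _ _ (is_Cderive_id z) IH).
Qed.

Lemma is_Cderive_peval (N : nat) (p : nat -> R) (z : C) :
  support_below p (S N) -> is_Cderive (peval N p) z (peval N (twist 0 p) z).
Proof.
  (* Without the support hypothesis, [twist 0 p] has one monomial too many. *)
  assert (H : forall N, is_Cderive (peval N p) z
      (peval N (twist 0 p) z - RtoC (INR (S N) * p (S N)) * z ^ N)%C).
  { clear N. intros N. induction N as [|N IH].
    - apply (is_Cderive_ext (fun _ => RtoC (p 0%nat))).
      { intros x. now rewrite peval_0. }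
      rewrite peval_0. unfold twist. simpl Cpow.
      replace (RtoC _ - _ * _)%C with (RtoC 0); [apply is_Cderive_const|].
      rewrite Cmult_1_r, <- RtoC_minus. f_equal. ring.
    - apply (is_Cderive_ext (fun x => peval N p x + RtoC (p (S N)) * x ^ S N)%C).
      { intros x. now rewrite peval_S. }
      eapply is_Cderive_eq.
      + apply is_Cderive_plus; [exact IH|].
        apply is_Cderive_mult; [apply is_Cderive_const | apply is_Cderive_pow].
      + cbv beta. rewrite peval_S. unfold twist.
        rewrite !RtoC_plus, !RtoC_mult. simpl Cpow. ring. }
  intros Hp. specialize (H N). rewrite (Hp (S N)) in H by lia.
  rewrite Rmult_0_r in H. now replace (_ - _)%C with (peval N (twist 0 p) z) in H by ring.
Qed.

Lemma is_Cderive_expoly (N : nat) (tau : R) (p q : nat -> R) (z : C) :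
  support_below p (S N) -> support_below q (S N) ->
  is_Cderive (expoly N tau p q) z (expoly N tau (twist 0 p) (twist (- tau) q) z).
Proof.
  intros Hp Hq. unfold expoly. apply is_Cderive_plus.
  { now apply is_Cderive_peval. }
  replace (peval N (twist (- tau) q) z)
    with (peval N (twist 0 q) z - RtoC tau * peval N q z)%C.
  2:{ rewrite (peval_ext N (twist (- tau) q)
        (fun k => 1 * twist 0 q k + (- tau) * q k)), peval_lin, RtoC_opp; [ring|].
      intros k _. unfold twist. ring. }
  set (e := Cexp (- (z * RtoC tau))).
  replace (e * (peval N (twist 0 q) z - RtoC tau * peval N q z))%C
    with (- RtoC tau * e * peval N q z + e * peval N (twist 0 q) z)%C by ring.
  apply (is_Cderive_mult (fun x => Cexp (- (x * RtoC tau)))).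
  - apply (is_Cderive_comp Cexp (fun x => - (x * RtoC tau))%C);
      [apply is_Cderive_Cexp|].
    replace (- RtoC tau)%C with (- (1 * RtoC tau + z * 0))%C by ring.
    apply (is_derive_opp (fun x : C => (x * RtoC tau)%C)).
    apply is_Cderive_mult; [apply is_Cderive_id | apply is_Cderive_const].
  - now apply is_Cderive_peval.
Qed.

Definition expoly_tower (N : nat) (tau : R) (p q : nat -> R) (k : nat) : C -> C :=
  expoly N tau (Nat.iter k (twist 0) p) (Nat.iter k (twist (- tau)) q).

Lemma expoly_tower_spec (N : nat) (tau : R) (p q : nat -> R) :
  support_below p (S N) -> support_below q (S N) ->
  deriv_tower (expoly_tower N tau p q).
Proof.
  intros Hp Hq k z. apply is_Cderive_expoly.
  - induction k as [|k IH]; [easy|]. now apply support_below_twist.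
  - induction k as [|k IH]; [easy|]. now apply support_below_twist.
Qed.

Lemma expoly_support_0 (N : nat) (tau : R) (p q : nat -> R) (z : C) :
  support_below p 0 ->
  expoly N tau p q z = (Cexp (- (z * RtoC tau)) * peval N q z)%C.
Proof. intros H. unfold expoly. rewrite (peval_support_0 N p) by easy. ring. Qed.

Lemma expoly_twist (N : nat) (tau c : R) (p q : nat -> R) (z : C) :
  (expoly N tau (twist 0 p) (twist (- tau) q) z + RtoC c * expoly N tau p q z)%C
  = expoly N tau (twist c p) (twist (c - tau) q) z.
Proof.
  unfold expoly.
  rewrite (peval_ext N (twist c p) (fun k => 1 * twist 0 p k + c * p k)),
    (peval_ext N (twist (c - tau) q) (fun k => 1 * twist (- tau) q k + c * q k)),
    !peval_lin; [ring| |]; intros k _; unfold twist; ring.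
Qed.

Lemma vanishes_expoly_twist (N m : nat) (tau c : R) (p q : nat -> R) (z0 : C) :
  support_below p (S N) -> support_below q (S N) ->
  vanishes (expoly N tau p q) z0 (S m) ->
  vanishes (expoly N tau (twist c p) (twist (c - tau) q)) z0 m.
Proof.
  intros Hp Hq V.
  eapply vanishes_ext; [intros z; apply expoly_twist|].
  apply (vanishes_twist (expoly N tau p q)
           (expoly N tau (twist 0 p) (twist (- tau) q))); [|easy].
  intros z. now apply is_Cderive_expoly.
Qed.

Lemma support_below_1 (p : nat -> R) :
  support_below (twist 0 p) 0 -> support_below p 1.
Proof.
  intros H k Hk. specialize (H (k - 1)%nat ltac:(lia)). unfold twist in H.
  replace (S (k - 1)) with k in H by lia.
  apply (Rmult_eq_reg_l (INR k)); [lra|]. apply not_0_INR. lia.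
Qed.

(** Induction on [n]: [D + tau] lowers the degree of [q] without changing that of
    [p] and is injective on [p], so the induction hypothesis leaves only a constant
    [q], which is then zero because [f z0 = 0]. For [n = 0] the same induction on
    [m], with [D] in place of [D + tau], treats the polynomial [p]. *)
Lemma expoly_unisolvent (N n m : nat) (tau : R) (p q : nat -> R) (z0 : C) :
  tau <> 0 -> (m <= S N)%nat -> (n <= S N)%nat ->
  support_below p m -> support_below q n ->
  vanishes (expoly N tau p q) z0 (m + n) ->
  support_below p 0 /\ support_below q 0.
Proof.
  intros Htau. revert m p q. induction n as [|n IHn].
  - intros m; induction m as [|m IHm]; [easy|].
    intros p q HmN HnN Hp Hq V.
    assert (Hp1 : support_below p 1).
    { apply support_below_1.
      apply (IHm (twist 0 p) (twist (0 - tau) q)); try lia.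
      - now apply support_below_deriv.
      - now apply support_below_twist.
      - apply vanishes_expoly_twist; [| |exact V]; eapply support_below_weaken; eauto. }
    split; [|easy]. destruct V as (F & F0 & _ & V).
    specialize (V 0%nat ltac:(lia)). rewrite F0 in V. unfold expoly in V.
    rewrite peval_support_1, (peval_support_0 N q), Cmult_0_r, Cplus_0_r in V by easy.
    apply RtoC_inj in V. intros [|k] _; [easy | apply Hp1; lia].
  - intros m p q HmN HnN Hp Hq V.
    destruct (IHn m (twist tau p) (twist (tau - tau) q)) as [H1 H2]; try lia.
    + now apply support_below_twist.
    + rewrite Rminus_diag. now apply support_below_deriv.
    + rewrite <- plus_n_Sm in V.
      apply vanishes_expoly_twist; [| |exact V]; eapply support_below_weaken; eauto.
    + rewrite Rminus_diag in H2. apply support_below_1 in H2.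
      apply (twist_eq_0 tau p m) in H1; [|easy|easy]. split; [easy|].
      destruct V as (F & F0 & _ & V). specialize (V 0%nat ltac:(lia)).
      rewrite F0, expoly_support_0, peval_support_1 in V by easy.
      intros [|k] _; [|apply H2; lia].
      apply RtoC_inj. destruct (Ceq_dec (RtoC (q 0%nat)) 0) as [E|E]; [easy|].
      now apply Cmult_neq_0 in V; [|apply Cexp_neq_0|].
Qed.

(** * The differential equation *)

(** A confluent hypergeometric equation: [z ^ (2 n) M(n, 2 n + 1, - tau z)] is a
    solution, where [M] is Kummer's function. *)
Definition kummer_ode (n : nat) (tau : R) (F : nat -> C -> C) : Prop :=
  forall z, (z * F 2%nat z + (RtoC tau * z + RtoC (1 - 2 * INR n)) * F 1%nat z
             - RtoC (INR n * tau) * F 0%nat z = 0)%C.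

(** The Euler operator [z D] is diagonal on monomials. *)
Lemma Cmult_peval_deriv (N : nat) (p : nat -> R) (z : C) :
  support_below p (S N) ->
  (z * peval N (twist 0 p) z)%C = peval N (fun k => INR k * p k) z.
Proof.
  intros Hp.
  assert (H : forall N, (z * peval N (twist 0 p) z)%C
            = peval (S N) (fun k => INR k * p k) z).
  { clear. intros N. induction N as [|N IH].
    - rewrite peval_S, !peval_0. unfold twist. simpl.
      rewrite !RtoC_plus, !RtoC_mult. ring.
    - rewrite peval_S, Cmult_plus_distr_l, IH, (peval_S (S N)). f_equal.
      unfold twist. rewrite RtoC_plus, !RtoC_mult. simpl Cpow. ring. }
  rewrite H, peval_S, Hp by lia. rewrite Rmult_0_r. ring.
Qed.

(** The differential operator maps [p] to a polynomial and [exp (- tau z) q] to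
    [exp (- tau z)] times a polynomial; the two recurrences say that the
    coefficients of both polynomials are zero. *)
Lemma expoly_kummer_ode (N n : nat) (tau : R) (p q : nat -> R) :
  support_below p (S N) -> support_below q (S N) ->
  (forall k, INR (S k) * (INR (S k) - 2 * INR n) * p (S k)
             = tau * (INR n - INR k) * p k) ->
  (forall k, INR (S k) * (INR (S k) - 2 * INR n) * q (S k)
             = tau * (INR (S k) - INR n) * q k) ->
  kummer_ode n tau (expoly_tower N tau p q).
Proof.
  intros Sp Sq Hp Hq z. unfold expoly_tower; simpl Nat.iter.
  set (p1 := twist 0 p). set (q1 := twist (- tau) q).
  assert (Sp1 : support_below p1 (S N)) by now apply support_below_twist.
  assert (Sq1 : support_below q1 (S N)) by now apply support_below_twist.
  assert (Ep : (z * peval N (twist 0 p1) z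
      + (RtoC tau * z + RtoC (1 - 2 * INR n)) * peval N p1 z
      - RtoC (INR n * tau) * peval N p z = 0)%C).
  { rewrite Cmult_plus_distr_r, <- Cmult_assoc.
    rewrite Cmult_peval_deriv by easy. unfold p1 at 2.
    rewrite Cmult_peval_deriv by easy.
    rewrite <- (peval_support_0 N (fun _ => 0) z) by easy.
    rewrite (peval_ext N (fun _ => 0) (fun k =>
      1 * (INR k * p1 k) + 1 * (tau * (INR k * p k)
        + 1 * ((1 - 2 * INR n) * p1 k + - (INR n * tau) * p k)))).
    - rewrite !peval_lin, RtoC_opp. ring.
    - intros k _. specialize (Hp k). unfold p1, twist.
      rewrite S_INR in *. lra. }
  assert (Ht : forall r, support_below r (S N) ->
      (z * peval N (twist (- tau) r) z)%C
      = (peval N (fun k => INR k * r k)%R z - RtoC tau * z * peval N r z)%C).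
  { intros r Hr. rewrite <- Cmult_peval_deriv by easy.
    rewrite (peval_ext N (twist (- tau) r) (fun k => 1 * twist 0 r k + (- tau) * r k)).
    - rewrite peval_lin, RtoC_opp. ring.
    - intros k _. unfold twist. ring. }
  assert (Eq : (z * peval N (twist (- tau) q1) z
      + (RtoC tau * z + RtoC (1 - 2 * INR n)) * peval N q1 z
      - RtoC (INR n * tau) * peval N q z = 0)%C).
  { rewrite (Ht q1) by easy.
    rewrite <- (peval_support_0 N (fun _ => 0) z) by easy.
    rewrite (peval_ext N (fun _ => 0) (fun k =>
      1 * (INR k * q1 k) + 1 * ((1 - 2 * INR n) * q1 k + - (INR n * tau) * q k))).
    - rewrite !peval_lin, RtoC_opp. ring.
    - intros k _. specialize (Hq k). unfold q1, twist.
      rewrite S_INR in *. lra. }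
  unfold expoly. fold p1 q1.
  transitivity (0 + Cexp (- (z * RtoC tau)) * 0)%C; [|ring].
  rewrite <- Ep at 1. rewrite <- Eq at 1. ring.
Qed.

(** By induction on [m]: differentiating the identity for [m], which holds on the
    whole plane, gives the identity for [S m]. *)
Lemma kummer_ode_deriv (n : nat) (tau : R) (F : nat -> C -> C) (m : nat) (z : C) :
  deriv_tower F -> kummer_ode n tau F ->
  (z * F (S (S m)) z + (RtoC tau * z + RtoC (INR m + 1 - 2 * INR n)) * F (S m) z
   + RtoC ((INR m - INR n) * tau) * F m z = 0)%C.
Proof.
  intros HF Hode. revert z. induction m as [|m IH]; intros z.
  - rewrite <- (Hode z) at 1. simpl INR.
    replace (0 + 1 - 2 * INR n) with (1 - 2 * INR n) by ring.
    replace ((0 - INR n) * tau) with (- (INR n * tau)) by ring.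
    rewrite RtoC_opp. ring.
  - eapply is_Cderive_unique; [|apply (is_Cderive_const 0 z)].
    eapply is_Cderive_ext; [exact IH|].
    eapply is_Cderive_eq.
    + refine (is_Cderive_plus _ _ _ _ _ (is_Cderive_plus _ _ _ _ _
        (is_Cderive_mult (fun x => x) (F _) _ _ _ (is_Cderive_id z) (HF _ z))
        (is_Cderive_mult (fun x => RtoC tau * x + RtoC _)%C (F _) _ _ _ _ (HF _ z)))
        (is_Cderive_mult (fun _ => RtoC _) (F _) _ _ _ (is_Cderive_const _ z) (HF _ z))).
      exact (is_Cderive_plus _ _ _ _ _
        (is_Cderive_mult (fun _ => RtoC tau) (fun x => x) _ _ _
           (is_Cderive_const _ z) (is_Cderive_id z))
        (is_Cderive_const _ z)).
    + cbv beta. rewrite S_INR.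
      rewrite !RtoC_mult, !RtoC_minus, !RtoC_plus. ring.
Qed.

(** At [z = 0] the [m]-th derivative of the equation reads
    [(m + 1 - 2 n) F (m + 1) 0 = (n - m) tau F m 0], and the factor on the left is
    nonzero for [m + 1 < 2 n]. *)
Lemma kummer_ode_vanishes (n : nat) (tau : R) (F : nat -> C -> C) :
  deriv_tower F -> kummer_ode n tau F -> F 0%nat (RtoC 0) = RtoC 0 ->
  forall m, (m < 2 * n)%nat -> F m (RtoC 0) = RtoC 0.
Proof.
  intros HF Hode H0 m. induction m as [|m IH]; [easy|]. intros Hm.
  pose proof (kummer_ode_deriv n tau F m 0 HF Hode) as E.
  rewrite IH in E by lia.
  assert (E' : (RtoC (INR m + 1 - 2 * INR n) * F (S m) 0 = 0)%C)
    by (etransitivity; [|exact E]; ring).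
  destruct (Ceq_dec (F (S m) 0) 0) as [|Hne]; [easy|].
  exfalso. apply (Cmult_neq_0 (RtoC (INR m + 1 - 2 * INR n)) (F (S m) 0)); [|easy|easy].
  intros Z%RtoC_inj. rewrite <- S_INR in Z.
  apply lt_INR in Hm. rewrite mult_INR in Hm. simpl (INR 2) in Hm. lra.
Qed.

(** * Zeros in the right half-plane *)

Lemma is_derive_Re_ray (f : C -> C) (w l : C) (r : R) :
  is_Cderive f (RtoC r * w)%C l ->
  is_derive (fun t => Re (f (RtoC t * w)%C)) r (Re (w * l)%C).
Proof.
  intros H. apply is_derive_Reals. intros eps Heps.
  assert (Hw : 0 < Cmod w + 1) by (pose proof (Cmod_ge_0 w); lra).
  destruct (proj1 (is_Cderive_iff _ _ _) H (eps / (2 * (Cmod w + 1)))) as [d [Hd HH]].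
  { apply Rdiv_lt_0_compat; lra. }
  assert (Hd' : 0 < d / (Cmod w + 1)) by now apply Rdiv_lt_0_compat.
  exists (mkposreal _ Hd'). intros h Hh0 Hh. simpl in Hh.
  assert (Hhw : Cmod (RtoC h * w) <= Rabs h * (Cmod w + 1)).
  { rewrite Cmod_mult, Cmod_R. pose proof (Rabs_pos h).
    apply Rmult_le_compat_l; lra. }
  assert (Hhd : Cmod (RtoC h * w) < d).
  { eapply Rle_lt_trans; [exact Hhw|].
    apply (Rmult_lt_compat_r (Cmod w + 1)) in Hh; [|easy].
    unfold Rdiv in Hh. rewrite Rmult_assoc, Rinv_l, Rmult_1_r in Hh; lra. }
  specialize (HH _ Hhd).
  set (X := (f (RtoC r * w + RtoC h * w) - f (RtoC r * w) - RtoC h * w * l)%C) in HH.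
  assert (HX : Rabs (Re X) <= eps / 2 * Rabs h).
  { eapply Rle_trans; [apply re_le_Cmod|]. eapply Rle_trans; [exact HH|].
    apply Rle_trans with (eps / (2 * (Cmod w + 1)) * (Rabs h * (Cmod w + 1))).
    - apply Rmult_le_compat_l; [|easy]. left. apply Rdiv_lt_0_compat; lra.
    - right. field. lra. }
  replace ((Re (f (RtoC (r + h) * w)%C) - Re (f (RtoC r * w)%C)) / h - Re (w * l)%C)
    with (Re X / h).
  2:{ unfold X. rewrite RtoC_plus, Cmult_plus_distr_r.
      generalize (f (RtoC r * w + RtoC h * w)%C) (f (RtoC r * w)%C).
      intros p q. unfold Re. simpl. field. easy. }
  unfold Rdiv. rewrite Rabs_mult, Rabs_inv.
  pose proof (Rabs_pos_lt h Hh0) as Hp.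
  apply (Rmult_lt_reg_r (Rabs h)); [easy|].
  rewrite Rmult_assoc, Rinv_l by lra. nra.
Qed.

Lemma is_derive_Im_ray (f : C -> C) (w l : C) (r : R) :
  is_Cderive f (RtoC r * w)%C l ->
  is_derive (fun t => Im (f (RtoC t * w)%C)) r (Im (w * l)%C).
Proof.
  intros H.
  apply (is_derive_ext (fun t => Re ((fun z => - Ci * f z)%C (RtoC t * w)%C))).
  { intros t. unfold Re, Im. simpl. ring. }
  replace (Im (w * l)%C) with (Re (w * (- Ci * l))%C) by (unfold Re, Im; simpl; ring).
  apply (is_derive_Re_ray (fun z => - Ci * f z)%C).
  eapply is_Cderive_eq.
  - apply is_Cderive_mult; [apply is_Cderive_const | exact H].
  - cbv beta. ring.
Qed.

(** Taylor's bound at a zero of order [m], by repeated use of the mean value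
    inequality. *)
Lemma flat_bound (m : nat) (h : nat -> R -> R) :
  (forall k r, is_derive (h k) r (h (S k) r)) ->
  (forall k, (k < m)%nat -> h k 0 = 0) ->
  exists M, 0 <= M /\ forall r, Rabs r <= 1 -> Rabs (h 0%nat r) <= M * Rabs r ^ m.
Proof.
  revert h. induction m as [|m IH]; intros h Hh H0.
  - destruct (continuity_ab_maj (fun r => Rabs (h 0%nat r)) (-1) 1) as [x [Hx _]].
    + lra.
    + intros r _. apply (continuity_pt_comp (h 0%nat) Rabs).
      * apply derivable_continuous_pt. exists (h 1%nat r).
        apply is_derive_Reals, Hh.
      * apply Rcontinuity_abs.
    + exists (Rabs (h 0%nat x)). split; [apply Rabs_pos|].
      intros r Hr. rewrite pow_O, Rmult_1_r. apply Hx. now apply Rabs_le_between.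
  - destruct (IH (fun k => h (S k))) as [M [HM HB]].
    + intros k r. apply Hh.
    + intros k Hk. apply H0. lia.
    + exists M; split; [easy|]. intros r Hr.
      pose proof (bounded_variation (h 0%nat) (h 1%nat) (M * Rabs r ^ m) 0 r) as V.
      rewrite Rminus_0_r, (H0 0%nat), Rminus_0_r in V by lia.
      simpl pow. replace (M * (Rabs r * Rabs r ^ m)) with (M * Rabs r ^ m * Rabs r) by ring.
      apply V. intros t Ht. rewrite Rminus_0_r in Ht. split; [apply Hh|].
      eapply Rle_trans; [apply HB; lra|].
      apply Rmult_le_compat_l; [easy|]. apply pow_incr. split; [apply Rabs_pos | easy].
Qed.

Lemma flat_bound_ray (F : nat -> C -> C) (w : C) (m : nat) :
  deriv_tower F -> (forall k, (k < m)%nat -> F k (RtoC 0) = RtoC 0) ->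
  exists M, 0 <= M /\ forall r, 0 <= r <= 1 ->
    Rabs (Re (F 0%nat (RtoC r * w)%C)) <= M * r ^ m
    /\ Rabs (Im (F 0%nat (RtoC r * w)%C)) <= M * r ^ m.
Proof.
  intros HF H0.
  assert (HD : forall k z, is_Cderive (fun x => w ^ k * F k x)%C z
                                      (w ^ k * F (S k) z)%C).
  { intros k z. eapply is_Cderive_eq.
    - apply is_Cderive_mult; [apply is_Cderive_const | apply HF].
    - cbv beta. ring. }
  assert (HZ : forall k, (k < m)%nat -> (w ^ k * F k (RtoC 0 * w) = 0)%C).
  { intros k Hk. rewrite Cmult_0_l, H0 by easy. ring. }
  destruct (flat_bound m (fun k r => Re (w ^ k * F k (RtoC r * w))%C)) as [M [HM HB]].
  { intros k r. replace (w ^ S k * F (S k) (RtoC r * w))%C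
      with (w * (w ^ k * F (S k) (RtoC r * w)))%C by (simpl; ring).
    apply (is_derive_Re_ray (fun x => w ^ k * F k x)%C), HD. }
  { intros k Hk. now rewrite HZ. }
  destruct (flat_bound m (fun k r => Im (w ^ k * F k (RtoC r * w))%C)) as [M' [HM' HB']].
  { intros k r. replace (w ^ S k * F (S k) (RtoC r * w))%C
      with (w * (w ^ k * F (S k) (RtoC r * w)))%C by (simpl; ring).
    apply (is_derive_Im_ray (fun x => w ^ k * F k x)%C), HD. }
  { intros k Hk. now rewrite HZ. }
  exists (M + M'). split; [lra|]. intros r Hr.
  specialize (HB r). specialize (HB' r). cbv beta in HB, HB'.
  rewrite Rabs_pos_eq in HB, HB' by lra. simpl (w ^ 0)%C in HB, HB'.
  rewrite Cmult_1_l in HB, HB'. specialize (HB ltac:(lra)). specialize (HB' ltac:(lra)).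
  assert (0 <= r ^ m) by (apply pow_le; lra). split; nra.
Qed.

(** Hille's argument along the segment from [0] to [w]. With
    [f = F 0], [f' = F 1] and [u r = exp (tau r w / 2) f (r w)], the function
    [Re (conj w u' (conj u)) r ^ (1 - 2 n)] is, up to the factor [|w|^2],
<<
      E r = exp (tau r Re w) (Re (f' conj f) + tau / 2 |f|^2) r ^ (1 - 2 n),
>>
    where no complex exponential is left. By the equation its derivative is
<<
      exp (tau r Re w) r ^ (- 2 n)
        (tau / 2 |f|^2 + r Re w |f' + tau / 2 f|^2 + tau^2 r Re w / 4 |f|^2),
>>
    which is nonnegative when [0 <= Re w], and is zero only where [f] is. *)
Lemma kummer_ode_ray_zero (n : nat) (tau : R) (F : nat -> C -> C) (w : C) :
  (0 < n)%nat -> 0 < tau -> deriv_tower F -> kummer_ode n tau F ->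
  (forall k, (k < 2 * n)%nat -> F k (RtoC 0) = RtoC 0) ->
  F 0%nat w = RtoC 0 -> 0 <= Re w ->
  forall r, 0 < r < 1 -> F 0%nat (RtoC r * w)%C = RtoC 0.
Proof.
  intros Hn Htau HF Hode HV Hw Hre.
  set (u := Re w) in *. set (v := Im w).
  set (A := fun r => Re (F 0%nat (RtoC r * w)%C)).
  set (B := fun r => Im (F 0%nat (RtoC r * w)%C)).
  set (A1 := fun r => Re (F 1%nat (RtoC r * w)%C)).
  set (B1 := fun r => Im (F 1%nat (RtoC r * w)%C)).
  set (A2 := fun r => Re (F 2%nat (RtoC r * w)%C)).
  set (B2 := fun r => Im (F 2%nat (RtoC r * w)%C)).
  assert (dA : forall r, is_derive A r (u * A1 r - v * B1 r))
    by (intros r; exact (is_derive_Re_ray _ w _ r (HF 0%nat _))).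
  assert (dB : forall r, is_derive B r (u * B1 r + v * A1 r))
    by (intros r; exact (is_derive_Im_ray _ w _ r (HF 0%nat _))).
  assert (dA1 : forall r, is_derive A1 r (u * A2 r - v * B2 r))
    by (intros r; exact (is_derive_Re_ray _ w _ r (HF 1%nat _))).
  assert (dB1 : forall r, is_derive B1 r (u * B2 r + v * A2 r))
    by (intros r; exact (is_derive_Im_ray _ w _ r (HF 1%nat _))).
  set (m := (2 * n - 2)%nat).
  (* The powers of [r] are [r ^ (2 n - 1) = r ^ S m] and [r ^ (2 n)]. *)
  assert (Em : (2 * n)%nat = S (S m)) by lia.
  assert (Nm : 2 * INR n = INR m + 2).
  { rewrite <- (mult_INR 2), Em, !S_INR. ring. }
  set (e := fun r => A1 r * A r + B1 r * B r + tau / 2 * (A r ^ 2 + B r ^ 2)).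
  set (E := fun r => exp (tau * u * r) * e r / r ^ S m).
  set (D := fun r => exp (tau * u * r) / r ^ S (S m) *
     (tau / 2 * (A r ^ 2 + B r ^ 2)
      + r * u * ((A1 r + tau / 2 * A r) ^ 2 + (B1 r + tau / 2 * B r) ^ 2)
      + tau ^ 2 * r * u / 4 * (A r ^ 2 + B r ^ 2))).
  assert (dE : forall r, 0 < r -> is_derive E r (D r)).
  { intros r Hr. unfold E, e.
    auto_derive.
    - repeat split; try (eexists; eauto; fail).
      apply Rgt_not_eq, (pow_lt r (S m)), Hr.
    - replace (Derive (fun x => A x) r) with (u * A1 r - v * B1 r)
        by (symmetry; apply is_derive_unique, dA).
      replace (Derive (fun x => B x) r) with (u * B1 r + v * A1 r)
        by (symmetry; apply is_derive_unique, dB).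
      replace (Derive (fun x => A1 x) r) with (u * A2 r - v * B2 r)
        by (symmetry; apply is_derive_unique, dA1).
      replace (Derive (fun x => B1 x) r) with (u * B2 r + v * A2 r)
        by (symmetry; apply is_derive_unique, dB1).
      pose proof (Hode (RtoC r * w)%C) as O.
      assert (O1 : r * (u * A2 r - v * B2 r) + (tau * r * u + 1 - 2 * INR n) * A1 r
                   - tau * r * v * B1 r - INR n * tau * A r = 0).
      { apply (f_equal Re) in O. cbn in O. unfold A, A1, A2, B, B1, B2, u, v, Re, Im.
        cbn. rewrite <- O. ring. }
      assert (O2 : r * (u * B2 r + v * A2 r) + (tau * r * u + 1 - 2 * INR n) * B1 r
                   + tau * r * v * A1 r - INR n * tau * B r = 0).
      { apply (f_equal Im) in O. cbn in O. unfold A, A1, A2, B, B1, B2, u, v, Re, Im.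
        cbn. rewrite <- O. ring. }
      (* Eliminate the second derivatives with the equation. *)
      assert (P : u * A2 r - v * B2 r
          = (INR n * tau * A r + tau * r * v * B1 r
             - (tau * r * u + 1 - 2 * INR n) * A1 r) / r)
        by (apply (Rmult_eq_reg_l r); [field_simplify; lra | lra]).
      assert (Q : u * B2 r + v * A2 r
          = (INR n * tau * B r - tau * r * v * A1 r
             - (tau * r * u + 1 - 2 * INR n) * B1 r) / r)
        by (apply (Rmult_eq_reg_l r); [field_simplify; lra | lra]).
      rewrite P, Q. clear P Q.
      change (match m with 0%nat => 1 | S _ => INR m + 1 end) with (INR (S m)).
      rewrite S_INR. replace (INR n) with ((INR m + 2) / 2) by lra.
      unfold D. simpl pow. field.
      split; [apply Rgt_not_eq, pow_lt|]; lra. }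
  assert (Dge : forall r, 0 < r ->
      exp (tau * u * r) / r ^ S (S m) * (tau / 2 * (A r ^ 2 + B r ^ 2)) <= D r).
  { intros r Hr. apply Rmult_le_compat_l.
    - left. apply Rdiv_lt_0_compat; [apply exp_pos | now apply pow_lt].
    - assert (0 <= r * u) by (apply Rmult_le_pos; lra).
      assert (0 <= tau ^ 2 * r * u / 4)
        by (replace (tau ^ 2 * r * u / 4) with ((tau / 2) ^ 2 * (r * u)) by field;
            apply Rmult_le_pos; [apply pow2_ge_0 | easy]).
      pose proof (pow2_ge_0 (A r)). pose proof (pow2_ge_0 (B r)).
      pose proof (pow2_ge_0 (A1 r + tau / 2 * A r)).
      pose proof (pow2_ge_0 (B1 r + tau / 2 * B r)). nra. }
  assert (Cpos : forall r, 0 < r -> 0 < exp (tau * u * r) / r ^ S (S m)).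
  { intros r Hr. apply Rdiv_lt_0_compat; [apply exp_pos | now apply pow_lt]. }
  assert (Emono : forall x y, 0 < x -> x <= y -> E x <= E y).
  { intros x y Hx Hxy.
    destruct (MVT_gen E x y D) as [c [Hc Hd]].
    - intros c Hc. rewrite Rmin_left in Hc by easy. apply dE. lra.
    - intros c Hc. rewrite Rmin_left in Hc by easy.
      apply derivable_continuous_pt. exists (D c). apply is_derive_Reals, dE. lra.
    - rewrite Rmin_left, Rmax_right in Hc by easy.
      assert (0 <= D c).
      { eapply Rle_trans; [|apply Dge; lra].
        apply Rmult_le_pos; [left; apply Cpos; lra|].
        pose proof (pow2_ge_0 (A c)). pose proof (pow2_ge_0 (B c)). nra. }
      nra. }
  assert (E1 : E 1 = 0).
  { unfold E, e, A, B. rewrite Cmult_1_l, Hw. simpl. field.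
    apply Rgt_not_eq, pow_lt. lra. }
  destruct (flat_bound_ray F w (2 * n) HF HV) as [M [HM HB]].
  destruct (flat_bound_ray (fun k => F (S k)) w 0) as [M1 [HM1 HB1]].
  { intros k z. apply HF. }
  { intros k Hk. lia. }
  (* [|f| <= M r ^ (2 n)] and [|f'| <= M1] componentwise; the term in [|f|^2] only
     helps in a lower bound. *)
  set (K := exp (tau * u) * (2 * (M1 * M))).
  assert (HK : 0 <= K).
  { apply Rmult_le_pos; [left; apply exp_pos|]. pose proof (Rmult_le_pos _ _ HM1 HM). lra. }
  assert (Elow : forall r, 0 < r <= 1 -> - (K * r) <= E r).
  { intros r Hr. destruct (HB r ltac:(lra)) as [a b].
    destruct (HB1 r ltac:(lra)) as [a1 b1]. simpl pow in a1, b1.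
    rewrite Rmult_1_r in a1, b1. fold (A r) in a. fold (B r) in b.
    fold (A1 r) in a1. fold (B1 r) in b1.
    assert (pr : 0 < r ^ S m) by (apply pow_lt; lra).
    assert (L1 : - (M1 * (M * r ^ (2 * n))) <= A1 r * A r).
    { assert (Rabs (A1 r * A r) <= M1 * (M * r ^ (2 * n)))
        by (rewrite Rabs_mult; apply Rmult_le_compat; try apply Rabs_pos; lra).
      apply Rabs_le_between in H. lra. }
    assert (L2 : - (M1 * (M * r ^ (2 * n))) <= B1 r * B r).
    { assert (Rabs (B1 r * B r) <= M1 * (M * r ^ (2 * n)))
        by (rewrite Rabs_mult; apply Rmult_le_compat; try apply Rabs_pos; lra).
      apply Rabs_le_between in H. lra. }
    assert (L3 : - (2 * (M1 * M) * r ^ (2 * n)) <= e r).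
    { unfold e. pose proof (pow2_ge_0 (A r)). pose proof (pow2_ge_0 (B r)). nra. }
    assert (X : 0 < exp (tau * u * r) <= exp (tau * u)).
    { split; [apply exp_pos|].
      assert (tau * u * r <= tau * u).
      { rewrite <- (Rmult_1_r (tau * u)) at 2. apply Rmult_le_compat_l; [|lra].
        apply Rmult_le_pos; lra. }
      destruct (Rle_lt_or_eq_dec _ _ H) as [H'|H'];
        [left; now apply exp_increasing | right; now rewrite H']. }
    unfold E. apply (Rmult_le_reg_r (r ^ S m)); [easy|].
    unfold Rdiv. rewrite Rmult_assoc, Rinv_l, Rmult_1_r by lra.
    rewrite Em in L3. change (r ^ S (S m)) with (r * r ^ S m) in L3.
    set (T := r * r ^ S m) in *.
    replace (- (K * r) * r ^ S m) with (- (K * T)) by (unfold T; ring).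
    assert (HT : 0 <= 2 * (M1 * M) * T).
    { repeat apply Rmult_le_pos; try lra. left; now apply pow_lt. }
    unfold K. nra. }
  assert (E0 : forall r, 0 < r < 1 -> E r = 0).
  { intros r Hr. apply Rle_antisym.
    - rewrite <- E1. apply Emono; lra.
    - apply Rnot_lt_le. intros Hneg.
      (* Small enough that [- (K * rho) > E r]. *)
      set (rho := Rmin r (- E r / (K + 1))).
      assert (0 < - E r / (K + 1)) by (apply Rdiv_lt_0_compat; lra).
      assert (Hrho : 0 < rho) by (apply Rmin_glb_lt; lra).
      pose proof (Rmin_l r (- E r / (K + 1))) as R1. fold rho in R1.
      pose proof (Rmin_r r (- E r / (K + 1))) as R2. fold rho in R2.
      pose proof (Emono rho r Hrho R1). pose proof (Elow rho ltac:(lra)).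
      apply (Rmult_le_compat_l (K + 1)) in R2; [|lra].
      replace ((K + 1) * (- E r / (K + 1))) with (- E r) in R2 by (field; lra).
      lra. }
  intros r Hr.
  assert (Dr : D r = 0).
  { rewrite <- (is_derive_unique E r _ (dE r ltac:(lra))).
    apply is_derive_unique. apply (is_derive_ext_loc (fun _ => 0)).
    - assert (Hd : 0 < Rmin r (1 - r)) by (apply Rmin_glb_lt; lra).
      exists (mkposreal _ Hd). intros y Hy. symmetry. apply E0.
      change (Rabs (y - r) < Rmin r (1 - r)) in Hy.
      pose proof (Rmin_l r (1 - r)). pose proof (Rmin_r r (1 - r)).
      apply Rabs_lt_between in Hy. lra.
    - exact (is_derive_const 0 r). }
  pose proof (Dge r ltac:(lra)) as G. rewrite Dr in G.
  pose proof (Cpos r ltac:(lra)).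
  pose proof (pow2_ge_0 (A r)). pose proof (pow2_ge_0 (B r)).
  assert (Z : A r ^ 2 + B r ^ 2 <= 0).
  { apply Rnot_lt_le. intros Z.
    assert (0 < tau / 2 * (A r ^ 2 + B r ^ 2)) by (apply Rmult_lt_0_compat; lra).
    nra. }
  apply injective_projections.
  - change (A r = 0). nra.
  - change (B r = 0). nra.
Qed.

(** Along the ray, the derivative of [F k] is [w] times [F (S k)]. *)
Lemma deriv_tower_zero_ray (F : nat -> C -> C) (w : C) :
  deriv_tower F -> w <> RtoC 0 ->
  (forall r, 0 < r < 1 -> F 0%nat (RtoC r * w)%C = RtoC 0) ->
  forall k r, 0 < r < 1 -> F k (RtoC r * w)%C = RtoC 0.
Proof.
  intros HF Hw H0 k. induction k as [|k IH]; [exact H0|]. intros r Hr.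
  assert (Hloc : locally r (fun t => F k (RtoC t * w)%C = RtoC 0)).
  { assert (Hd : 0 < Rmin r (1 - r)) by (apply Rmin_glb_lt; lra).
    exists (mkposreal _ Hd). intros y Hy. apply IH.
    change (Rabs (y - r) < Rmin r (1 - r)) in Hy.
    pose proof (Rmin_l r (1 - r)). pose proof (Rmin_r r (1 - r)).
    apply Rabs_lt_between in Hy. lra. }
  assert (Hre : Re (w * F (S k) (RtoC r * w))%C = 0).
  { rewrite <- (is_derive_unique _ _ _ (is_derive_Re_ray _ w _ r (HF k _))).
    apply is_derive_unique, (is_derive_ext_loc (fun _ => 0)).
    - revert Hloc. apply filter_imp. now intros t ->.
    - exact (is_derive_const 0 r). }
  assert (Him : Im (w * F (S k) (RtoC r * w))%C = 0).
  { rewrite <- (is_derive_unique _ _ _ (is_derive_Im_ray _ w _ r (HF k _))).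
    apply is_derive_unique, (is_derive_ext_loc (fun _ => 0)).
    - revert Hloc. apply filter_imp. now intros t ->.
    - exact (is_derive_const 0 r). }
  destruct (Ceq_dec (F (S k) (RtoC r * w)%C) 0) as [|Hne]; [easy|].
  exfalso. apply (Cmult_neq_0 w (F (S k) (RtoC r * w)%C)); [easy|easy|].
  now apply injective_projections.
Qed.

(** * The coefficients in powers of [s - s0] *)

Lemma Cmult_peval (N : nat) (p : nat -> R) (z : C) :
  (z * peval N p z)%C
  = peval (S N) (fun k => match k with 0%nat => 0 | S j => p j end) z.
Proof.
  induction N as [|N IH].
  - rewrite peval_S, !peval_0. simpl. ring.
  - rewrite peval_S, Cmult_plus_distr_l, IH, (peval_S (S N)). simpl. ring.
Qed.

Lemma Binomial_C_n_0 (n : nat) : Binomial.C n 0 = 1.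
Proof.
  unfold Binomial.C. rewrite Nat.sub_0_r. simpl (fact 0). simpl (INR 1).
  field. apply INR_fact_neq_0.
Qed.

Lemma Binomial_C_n_n (n : nat) : Binomial.C n n = 1.
Proof.
  unfold Binomial.C. rewrite Nat.sub_diag. simpl (fact 0). simpl (INR 1).
  field. apply INR_fact_neq_0.
Qed.

(** The truncation [bin] makes Pascal's rule hold at both ends: [Binomial.C m k] is
    not zero for [m < k]. *)
Lemma Cpow_binomial (m : nat) (c : R) (z : C) :
  ((z + RtoC c) ^ m)%C = peval m (fun k => Binomial.C m k * c ^ (m - k)) z.
Proof.
  set (bin := fun m k => if (k <=? m)%nat then Binomial.C m k * c ^ (m - k) else 0).
  transitivity (peval m (bin m) z).
  2:{ apply peval_ext. intros k Hk. unfold bin.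
      now destruct (Nat.leb_spec k m); [|lia]. }
  induction m as [|m IH].
  - rewrite peval_0. unfold bin. simpl. rewrite Binomial_C_n_0. f_equal. ring.
  - simpl Cpow. rewrite IH, Cmult_plus_distr_r, Cmult_peval.
    replace (peval m (bin m) z) with (peval (S m) (bin m) z).
    2:{ rewrite peval_S. unfold bin at 2.
        destruct (Nat.leb_spec (S m) m); [lia | ring]. }
    rewrite (peval_ext (S m) (bin (S m)) (fun k =>
      1 * match k with 0%nat => 0 | S j => bin m j end + c * bin m k)).
    { rewrite peval_lin. ring. }
    intros [|k] Hk; unfold bin.
    + rewrite !Binomial_C_n_0, !Nat.sub_0_r. simpl. ring.
    + destruct (Nat.leb_spec (S k) (S m)); [|lia].
      destruct (Nat.leb_spec k m); [|lia].
      destruct (Nat.leb_spec (S k) m).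
      * rewrite <- pascal by lia. replace (S m - S k)%nat with (m - k)%nat by lia.
        replace (m - k)%nat with (S (m - S k)) by lia. simpl pow. ring.
      * replace k with m by lia. rewrite !Binomial_C_n_n, !Nat.sub_diag. ring.
Qed.

Definition recentre (N : nat) (b : nat -> R) (c : R) (k : nat) : R :=
  sum_n_m (fun j => b j * Binomial.C j k * c ^ (j - k)) k N.

Lemma peval_recentre (N : nat) (b : nat -> R) (c : R) (z : C) :
  peval N b (z + RtoC c)%C = peval N (recentre N b c) z.
Proof.
  induction N as [|N IH].
  - rewrite !peval_0. unfold recentre. rewrite sum_n_n, Binomial_C_n_0.
    simpl. f_equal. ring.
  - rewrite peval_S, Cpow_binomial, IH, !peval_S.
    rewrite (peval_ext N (recentre (S N) b c) (fun k =>
      1 * recentre N b c k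
      + b (S N) * (Binomial.C (S N) k * c ^ (S N - k)))).
    + rewrite peval_lin. unfold recentre at 3. rewrite sum_n_n, !RtoC_mult. ring.
    + intros k Hk. unfold recentre. rewrite sum_n_Sm by lia.
      change plus with Rplus. simpl. ring.
Qed.

(** The coefficients of the theorem re-expanded in powers of [s - s0], where they
    become single terms; [exp (s0 * tau)] is absorbed by the shift. The value at
    [j = n] is the leading coefficient [1]. *)
Definition centred_a (n : nat) (tau : R) (j : nat) : R :=
  if (j <=? n)%nat
  then (-1) ^ (n - j) * INR (fact n) / INR (fact j)
       * Binomial.C (2 * n - j - 1) (n - 1) / tau ^ (n - j)
  else 0.

Definition centred_alpha (n : nat) (tau : R) (j : nat) : R :=
  if (j <? n)%nat
  then (-1) ^ (n - 1) * INR (fact (2 * n - j - 1))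
       / (INR (fact j) * INR (fact (n - j - 1))) / tau ^ (n - j)
  else 0.

Lemma support_centred_a (n : nat) (tau : R) : support_below (centred_a n tau) (S n).
Proof. intros k Hk. unfold centred_a. destruct (Nat.leb_spec k n); [lia | easy]. Qed.

Lemma support_centred_alpha (n : nat) (tau : R) : support_below (centred_alpha n tau) n.
Proof. intros k Hk. unfold centred_alpha. destruct (Nat.ltb_spec k n); [lia | easy]. Qed.

Lemma centred_a_n (n : nat) (tau : R) : (0 < n)%nat -> centred_a n tau n = 1.
Proof.
  intros Hn. unfold centred_a. rewrite Nat.leb_refl, Nat.sub_diag.
  replace (2 * n - n - 1)%nat with (n - 1)%nat by lia.
  rewrite Binomial_C_n_n. simpl. field. apply INR_fact_neq_0.
Qed.

Lemma coef_a_recentre (n : nat) (tau s0 : R) (k : nat) :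
  0 < tau -> (k < n)%nat ->
  coef_a n tau s0 k = recentre n (centred_a n tau) (- s0) k.
Proof.
  intros Htau Hk. unfold coef_a, recentre.
  set (f := fun j => centred_a n tau j * Binomial.C j k * (- s0) ^ (j - k)).
  pose proof (sum_n_Sm f k (n - 1) ltac:(lia)) as L.
  replace (S (n - 1)) with n in L by lia. rewrite L. change plus with Rplus.
  unfold f at 2. rewrite centred_a_n by lia.
  rewrite Rplus_comm. f_equal; [|ring].
  rewrite <- (sum_n_m_mult_l (K := R_Ring)).
  apply sum_n_m_ext_loc. intros j Hj. change mult with Rmult.
  unfold f, centred_a. destruct (Nat.leb_spec j n); [|lia].
  replace (n - k)%nat with (n - j + (j - k))%nat by lia.
  replace (- s0) with (-1 * s0) by ring.
  rewrite Rpow_mult_distr, pow_add.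
  match goal with |- @eq _ ?l ?r => change (l = r :> R) end. field.
  split; [apply INR_fact_neq_0 | apply pow_nonzero; lra].
Qed.

Lemma coef_alpha_recentre (n : nat) (tau s0 : R) (k : nat) :
  0 < tau -> (k < n)%nat ->
  coef_alpha n tau s0 k
  = exp (s0 * tau) * recentre (n - 1) (centred_alpha n tau) (- s0) k.
Proof.
  intros Htau Hk. unfold coef_alpha, recentre.
  rewrite <- !(sum_n_m_mult_l (K := R_Ring)).
  apply sum_n_m_ext_loc. intros j Hj. change mult with Rmult.
  unfold centred_alpha. destruct (Nat.ltb_spec j n); [|lia].
  replace (- s0) with (-1 * s0) by ring.
  rewrite Rpow_mult_distr. unfold Binomial.C.
  match goal with |- @eq _ ?l ?r => change (l = r :> R) end. field.
  repeat split; try apply INR_fact_neq_0; apply pow_nonzero; lra.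
Qed.

Lemma quasipoly_coef (n : nat) (tau s0 : R) (z : C) :
  (0 < n)%nat -> 0 < tau ->
  quasipoly n tau (coef_a n tau s0) (coef_alpha n tau s0) z
  = expoly n tau (centred_a n tau) (centred_alpha n tau) (z - RtoC s0)%C.
Proof.
  intros Hn Htau. unfold quasipoly, expoly.
  replace (z - RtoC s0)%C with (z + RtoC (- s0))%C by (rewrite RtoC_opp; ring).
  f_equal.
  - rewrite peval_recentre. destruct n as [|n]; [lia|].
    rewrite peval_S. unfold recentre at 2.
    rewrite sum_n_n, centred_a_n, Binomial_C_n_n, Nat.sub_diag by lia.
    replace (S n - 1)%nat with n by lia.
    change (sum_n (fun k => RtoC (coef_a (S n) tau s0 k) * z ^ k)%C n)
      with (peval n (coef_a (S n) tau s0) z).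
    rewrite (peval_ext n _ (recentre (S n) (centred_a (S n) tau) (- s0))).
    + simpl pow. rewrite !Rmult_1_r. ring.
    + intros k Hk. apply coef_a_recentre; [easy | lia].
  - destruct n as [|n]; [lia|].
    rewrite peval_S, (support_centred_alpha (S n) tau (S n)) by lia.
    rewrite peval_recentre. replace (S n - 1)%nat with n by lia.
    change (sum_n (fun k => RtoC (coef_alpha (S n) tau s0 k) * z ^ k)%C n)
      with (peval n (coef_alpha (S n) tau s0) z).
    set (g := recentre n (centred_alpha (S n) tau) (- s0)).
    rewrite (peval_ext n (coef_alpha _ _ _) (fun k => exp (s0 * tau) * g k + 0 * g k)).
    + rewrite peval_lin, <- Cexp_R.
      replace (- (z * RtoC tau))%C
        with (- ((z + RtoC (- s0)) * RtoC tau) + - RtoC (s0 * tau))%C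
        by (rewrite RtoC_opp, RtoC_mult; ring).
      rewrite Cexp_plus.
      assert (I : (Cexp (- RtoC (s0 * tau)) * Cexp (RtoC (s0 * tau)) = 1)%C).
      { rewrite <- Cexp_plus, Cplus_comm, Cplus_opp_r, Cexp_R, exp_0. easy. }
      transitivity (Cexp (- ((z + RtoC (- s0)) * RtoC tau))
        * (Cexp (- RtoC (s0 * tau)) * Cexp (RtoC (s0 * tau))) * peval n g z)%C;
        [ring | rewrite I; ring].
    + intros k Hk. rewrite coef_alpha_recentre by (easy || lia).
      replace (S n - 1)%nat with n by lia. unfold g. ring.
Qed.

(** The factor [INR n - INR k] is what lets the recurrence stop at degree [n]. *)
Lemma centred_a_rec (n : nat) (tau : R) (k : nat) : 0 < tau ->
  INR (S k) * (INR (S k) - 2 * INR n) * centred_a n tau (S k)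
  = tau * (INR n - INR k) * centred_a n tau k.
Proof.
  intros Htau. destruct (Nat.lt_trichotomy k n) as [Hk|[->|Hk]].
  - unfold centred_a. destruct (Nat.leb_spec k n); [|lia].
    destruct (Nat.leb_spec (S k) n) as [Hk'|]; [|lia].
    destruct (Nat.le_exists_sub (S k) n Hk') as [e [-> _]].
    unfold Binomial.C.
    replace (2 * (e + S k) - S k - 1)%nat with (2 * e + k)%nat by lia.
    replace (2 * (e + S k) - k - 1)%nat with (S (2 * e + k))%nat by lia.
    replace (e + S k - 1)%nat with (e + k)%nat by lia.
    replace (e + S k - S k)%nat with e by lia.
    replace (e + S k - k)%nat with (S e) by lia.
    replace (2 * e + k - (e + k))%nat with e by lia.
    replace (S (2 * e + k) - (e + k))%nat with (S e) by lia.
    rewrite (fact_simpl (2 * e + k)), (fact_simpl k), (fact_simpl e).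
    rewrite !mult_INR, !S_INR, !plus_INR, !S_INR, mult_INR.
    simpl (INR 2). simpl pow. pose proof (pos_INR e). pose proof (pos_INR k).
    field. repeat split; try apply INR_fact_neq_0; try apply pow_nonzero; lra.
  - rewrite (support_centred_a n tau (S n)) by lia. ring.
  - rewrite !(support_centred_a n tau) by lia. ring.
Qed.

Lemma centred_alpha_rec (n : nat) (tau : R) (k : nat) : 0 < tau ->
  INR (S k) * (INR (S k) - 2 * INR n) * centred_alpha n tau (S k)
  = tau * (INR (S k) - INR n) * centred_alpha n tau k.
Proof.
  intros Htau. destruct (Nat.lt_trichotomy (S k) n) as [Hk|[<-|Hk]].
  - unfold centred_alpha. destruct (Nat.ltb_spec k n); [|lia].
    destruct (Nat.ltb_spec (S k) n); [|lia].
    destruct (Nat.le_exists_sub (S (S k)) n Hk) as [e [-> _]].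
    replace (2 * (e + S (S k)) - S k - 1)%nat with (2 * e + k + 2)%nat by lia.
    replace (2 * (e + S (S k)) - k - 1)%nat with (S (2 * e + k + 2))%nat by lia.
    replace (e + S (S k) - S k - 1)%nat with e by lia.
    replace (e + S (S k) - k - 1)%nat with (S e) by lia.
    replace (e + S (S k) - S k)%nat with (S e) by lia.
    replace (e + S (S k) - k)%nat with (S (S e)) by lia.
    rewrite (fact_simpl (2 * e + k + 2)), (fact_simpl k), (fact_simpl e).
    rewrite !mult_INR, !S_INR, !plus_INR, !S_INR, mult_INR.
    simpl (INR 2). simpl (INR 0). rewrite <- !tech_pow_Rmult.
    pose proof (pos_INR e). pose proof (pos_INR k).
    field. repeat split; try apply INR_fact_neq_0; try apply pow_nonzero; lra.
  - rewrite (support_centred_alpha (S k) tau (S k)) by lia. ring.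
  - rewrite !(support_centred_alpha n tau) by lia. ring.
Qed.

(** * The quasipolynomial of the theorem *)

Lemma expoly_coef_ode (n : nat) (tau : R) : 0 < tau ->
  kummer_ode n tau (expoly_tower n tau (centred_a n tau) (centred_alpha n tau)).
Proof.
  intros Htau. apply expoly_kummer_ode.
  - apply support_centred_a.
  - apply (support_below_weaken _ n); [apply support_centred_alpha | lia].
  - intros k. now apply centred_a_rec.
  - intros k. now apply centred_alpha_rec.
Qed.

Lemma expoly_coef_tower (n : nat) (tau : R) :
  deriv_tower (expoly_tower n tau (centred_a n tau) (centred_alpha n tau)).
Proof.
  apply expoly_tower_spec; [apply support_centred_a|].
  apply (support_below_weaken _ n); [apply support_centred_alpha | lia].
Qed.

Lemma expoly_coef_flat (n : nat) (tau : R) (k : nat) :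
  (0 < n)%nat -> 0 < tau -> (k < 2 * n)%nat ->
  expoly_tower n tau (centred_a n tau) (centred_alpha n tau) k (RtoC 0) = RtoC 0.
Proof.
  intros Hn Htau. revert k. apply (kummer_ode_vanishes n tau).
  - apply expoly_coef_tower.
  - now apply expoly_coef_ode.
  - unfold expoly_tower. simpl Nat.iter. unfold expoly.
    assert (P0 : forall p, peval n p 0 = RtoC (p 0%nat)).
    { intros p. clear. induction n as [|n IH]; [apply peval_0|].
      rewrite peval_S, IH. simpl. ring. }
    rewrite !P0, Cmult_0_l.
    replace (- RtoC 0)%C with (RtoC 0) by ring. rewrite Cexp_R, exp_0.
    rewrite <- RtoC_mult, <- RtoC_plus. f_equal.
    unfold centred_a, centred_alpha. destruct (Nat.leb_spec 0 n); [|lia].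
    destruct (Nat.ltb_spec 0 n); [|lia]. rewrite !Nat.sub_0_r.
    unfold Binomial.C. replace (2 * n - 1 - (n - 1))%nat with n by lia.
    replace ((-1) ^ n) with (-1 * (-1) ^ (n - 1))
      by (rewrite tech_pow_Rmult; f_equal; lia).
    change (INR (fact 0)) with 1. field.
    repeat split; try apply INR_fact_neq_0; apply pow_nonzero; lra.
Qed.

Lemma expoly_coef_not_flat (n : nat) (tau : R) (z : C) :
  (0 < n)%nat -> 0 < tau ->
  ~ vanishes (expoly n tau (centred_a n tau) (centred_alpha n tau)) z (S n + n).
Proof.
  intros Hn Htau V.
  destruct (expoly_unisolvent n n (S n) tau (centred_a n tau) (centred_alpha n tau) z)
    as [H _]; try lia; try easy.
  - lra.
  - apply support_centred_a.
  - apply support_centred_alpha.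
  - specialize (H n ltac:(lia)). rewrite centred_a_n in H by easy. lra.
Qed.

Lemma quasipoly_coef_zero_of_order (n : nat) (tau s0 : R) :
  (0 < n)%nat -> 0 < tau ->
  zero_of_order (quasipoly n tau (coef_a n tau s0) (coef_alpha n tau s0))
    (RtoC s0) (2 * n).
Proof.
  intros Hn Htau.
  set (F := expoly_tower n tau (centred_a n tau) (centred_alpha n tau)).
  exists (fun k z => F k (z - RtoC s0)%C). split; [|split; [|split]].
  - intros z. now rewrite quasipoly_coef.
  - intros k z. eapply is_Cderive_eq.
    + apply (is_Cderive_comp (F k) (fun x => x - RtoC s0)%C).
      * apply expoly_coef_tower.
      * exact (is_Cderive_plus _ _ _ _ _ (is_Cderive_id z) (is_Cderive_const _ z)).
    + cbv beta. fold F. ring.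
  - intros k Hk. replace (RtoC s0 - RtoC s0)%C with (RtoC 0) by ring.
    now apply expoly_coef_flat.
  - replace (RtoC s0 - RtoC s0)%C with (RtoC 0) by ring. intros H.
    apply (expoly_coef_not_flat n tau (RtoC 0)); [easy|easy|].
    exists F. split; [easy|]. split; [apply expoly_coef_tower|].
    intros k Hk. destruct (Nat.eq_dec k (2 * n)) as [->|]; [easy|].
    apply expoly_coef_flat; lia || easy.
Qed.

Lemma quasipoly_coef_strictly_dominant (n : nat) (tau s0 : R) :
  (0 < n)%nat -> 0 < tau ->
  strictly_dominant_root
    (quasipoly n tau (coef_a n tau s0) (coef_alpha n tau s0)) (RtoC s0).
Proof.
  intros Hn Htau.
  set (F := expoly_tower n tau (centred_a n tau) (centred_alpha n tau)).
  split.
  - rewrite quasipoly_coef by easy.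
    replace (RtoC s0 - RtoC s0)%C with (RtoC 0) by ring.
    apply (expoly_coef_flat n tau 0); lia || easy.
  - intros s Hs Hz. rewrite quasipoly_coef in Hz by easy.
    set (w := (s - RtoC s0)%C) in Hz.
    apply Rnot_le_lt. intros Hle.
    assert (Hw : w <> RtoC 0).
    { intros E. apply Hs. replace s with (w + RtoC s0)%C by (unfold w; ring).
      rewrite E. ring. }
    assert (Hseg : forall r, 0 < r < 1 -> F 0%nat (RtoC r * w)%C = RtoC 0).
    { apply (kummer_ode_ray_zero n tau); try easy.
      - apply expoly_coef_tower.
      - now apply expoly_coef_ode.
      - intros k Hk. now apply expoly_coef_flat.
      - unfold w, Re. simpl. unfold Re in Hle. simpl in Hle. lra. }
    apply (expoly_coef_not_flat n tau (RtoC (1 / 2) * w)%C); [easy|easy|].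
    exists F. split; [easy|]. split; [apply expoly_coef_tower|].
    intros k _. apply deriv_tower_zero_ray; try easy.
    + apply expoly_coef_tower.
    + lra.
Qed.

Lemma quasipoly_ext (n : nat) (tau : R) (a alpha a' alpha' : nat -> R) (z : C) :
  (0 < n)%nat ->
  (forall k, (k < n)%nat -> a k = a' k /\ alpha k = alpha' k) ->
  quasipoly n tau a alpha z = quasipoly n tau a' alpha' z.
Proof.
  intros Hn H. unfold quasipoly. f_equal; f_equal.
  - apply sum_n_ext_loc. intros k Hk. destruct (H k ltac:(lia)) as [-> _]. easy.
  - apply sum_n_ext_loc. intros k Hk. destruct (H k ltac:(lia)) as [_ ->]. easy.
Qed.

(** The monomial [s ^ n] cancels in the difference of two quasipolynomials, so both
    degrees are below [n] and a zero of order [n + n] annihilates it. *)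
Lemma quasipoly_vanishes_unique (n : nat) (tau : R) (a alpha a' alpha' : nat -> R)
  (z0 : C) : (0 < n)%nat -> tau <> 0 ->
  vanishes (quasipoly n tau a alpha) z0 (2 * n) ->
  vanishes (quasipoly n tau a' alpha') z0 (2 * n) ->
  forall k, (k < n)%nat -> a k = a' k /\ alpha k = alpha' k.
Proof.
  intros Hn Htau V V' k Hk.
  set (p := fun k => if (k <? n)%nat then 1 * a k + -1 * a' k else 0).
  set (q := fun k => if (k <? n)%nat then 1 * alpha k + -1 * alpha' k else 0).
  destruct (expoly_unisolvent (n - 1) n n tau p q z0) as [Hp Hq]; try easy; try lia.
  - intros j Hj. unfold p. destruct (Nat.ltb_spec j n); [lia | easy].
  - intros j Hj. unfold q. destruct (Nat.ltb_spec j n); [lia | easy].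
  - replace (n + n)%nat with (2 * n)%nat by lia.
    eapply vanishes_ext; [|exact (vanishes_minus _ _ _ _ V V')].
    intros z. unfold expoly, quasipoly.
    fold (peval (n - 1) a z) (peval (n - 1) a' z)
      (peval (n - 1) alpha z) (peval (n - 1) alpha' z).
    rewrite (peval_ext (n - 1) p (fun k => 1 * a k + -1 * a' k)).
    2:{ intros j Hj. unfold p. destruct (Nat.ltb_spec j n); [easy | lia]. }
    rewrite (peval_ext (n - 1) q (fun k => 1 * alpha k + -1 * alpha' k)).
    2:{ intros j Hj. unfold q. destruct (Nat.ltb_spec j n); [easy | lia]. }
    rewrite !peval_lin.
    replace (RtoC (-1)) with (- RtoC 1)%C by (now rewrite <- RtoC_opp).
    ring.
  - specialize (Hp k ltac:(lia)). specialize (Hq k ltac:(lia)).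
    unfold p in Hp. unfold q in Hq. destruct (Nat.ltb_spec k n); [lra | lia].
Qed.

Theorem theorem7 (n : nat) (tau : R) (a alpha : nat -> R) (s0 : R)
  (hn : (0 < n)%nat) (htau : 0 < tau) :
  (zero_of_order (quasipoly n tau a alpha) (RtoC s0) (2 * n) <->
   forall k : nat, (k < n)%nat ->
     a k = coef_a n tau s0 k /\ alpha k = coef_alpha n tau s0 k) /\
  ((forall k : nat, (k < n)%nat ->
      a k = coef_a n tau s0 k /\ alpha k = coef_alpha n tau s0 k) ->
   strictly_dominant_root (quasipoly n tau a alpha) (RtoC s0)).
Proof.
  pose proof (quasipoly_coef_zero_of_order n tau s0 hn htau) as Z.
  split; [split|].
  - intros H. apply (quasipoly_vanishes_unique n tau _ _ _ _ (RtoC s0)); [easy|lra| |].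
    + now apply zero_of_order_vanishes.
    + now apply zero_of_order_vanishes.
  - intros H. destruct Z as (F & F0 & HF). exists F. split; [|easy].
    intros z. rewrite F0. symmetry. now apply quasipoly_ext.
  - intros H. destruct (quasipoly_coef_strictly_dominant n tau s0 hn htau) as [D1 D2].
    split.
    + rewrite <- D1. now apply quasipoly_ext.
    + intros s Hs Hz. apply D2; [easy|]. rewrite <- Hz.
      symmetry. now apply quasipoly_ext.
Qed.
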